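(* Let $\mathfrak{F}=(X,I,Y,R)$ be a frame with an $(n+1)$-ary sorted relation, of some sort $\sigma(R)=(i_{n+1};i_1\cdots i_n)$. If for any $w\in Z_{\overline{i_{n+1}}}$ and any $(n-1)$-tuple $\vec{p}[\_]_k$ with $p_j\in Z_{i_j}$, for each $j\in\{1,\ldots,n\}\setminus\{k\}$, the sections $wR'\vec{p}[\_]_k$ of the Galois dual relation $R'$ of $R$ are Galois sets, then $\overline{\alpha}_R$ distributes at the $k$-th argument place over arbitrary joins in $\mathcal{G}(Z_{i_k})$.
   Context: $(X,I,Y)$ is a polarity: $Z_1=X$, $Z_\partial=Y$, $I\subseteq X\times Y$, Galois maps $U^{\perp}=\{y\mid\forall x\in U\;xIy\}$, ${}^{\perp}V=\{x\mid \forall y\in V\;xIy\}$; Galois sets are stable $A={}^\perp(A^\perp)\subseteq X$ or co-stable $B=({}^\perp B)^\perp\subseteq Y$, forming complete lattices $\mathcal G(Z_1),\mathcal G(Z_\partial)$; $W'$ means $W^\perp$ or ${}^\perp W$ as sorted. $u|w$ means $uIw$ or $wIu$ according to sorts. $\overline 1=\partial,\overline\partial=1$. $R\subseteq Z_{i_{n+1}}\times\prod_j Z_{i_j}$; its Galois dual $R'$ is defined by $uR'\vec v$ iff $\forall w\,(wR\vec v\to w|u)$; $wR'\vec p[\_]_k=\{u\mid wR'\vec p[u]_k\}$, where $\vec p[u]_k$ is $\vec p$ with $u$ in the $k$-th place. $\alpha_R(\vec W)=\bigcup_{\vec w\in\vec W}R\vec w$ and $\overline\alpha_R(\vec F)=(\alpha_R(\vec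 F))''$ for Galois sets $F_j\in\mathcal G(Z_{i_j})$. *)

(* Defs.v *)
From mathcomp Require Import all_boot.
From mathcomp Require Import boolp classical_sets.

Set Implicit Arguments.
Unset Strict Implicit.
Unset Printing Implicit Defensive.

Local Open Scope classical_set_scope.

Inductive gsort := sort1 | sortd.

Definition bar (i : gsort) : gsort :=
  match i with sort1 => sortd | sortd => sort1 end.

Record polarity := Polarity {
  pX : Type;
  pY : Type;
  pI : pX -> pY -> Prop }.

Definition Z (P : polarity) (i : gsort) : Type :=
  match i with sort1 => pX P | sortd => pY P end.

(* The relation u | w, for u of sort i and w of the opposite sort. *)
Definition incid (P : polarity) (i : gsort) : Z P i -> Z P (bar i) -> Prop :=
  match i with
  | sort1 => fun x y => pI x y
  | sortd => fun y x => pI x y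
  end.

Definition rperp (P : polarity) (U : set (pX P)) : set (pY P) :=
  [set y | forall x, U x -> pI x y].

Definition lperp (P : polarity) (V : set (pY P)) : set (pX P) :=
  [set x | forall y, V y -> pI x y].

(* W'' is defined by cases on the sort, rather than by applying a sorted Galois
   map twice, because bar (bar i) and i are not convertible. *)
Definition gclosure (P : polarity) (i : gsort) : set (Z P i) -> set (Z P i) :=
  match i with
  | sort1 => fun U => lperp (rperp U)
  | sortd => fun V => rperp (lperp V)
  end.

Definition is_galois (P : polarity) (i : gsort) (W : set (Z P i)) : Prop :=
  W = gclosure W.

Record galois (P : polarity) (i : gsort) := Galois {
  gset :> set (Z P i);
  gsetP : is_galois gset }.

Lemma sub_gclosure (P : polarity) (i : gsort) (W : set (Z P i)) :
  W `<=` gclosure W.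
Proof. by case: i W => W u Wu v; apply. Qed.

Lemma gclosureS (P : polarity) (i : gsort) (V W : set (Z P i)) :
  V `<=` W -> gclosure V `<=` gclosure W.
Proof.
by case: i V W => V W VW u Vu v Wv; apply: Vu => w Vw; apply/Wv/VW.
Qed.

Lemma gclosure_galois (P : polarity) (i : gsort) (W : set (Z P i)) :
  is_galois (gclosure W).
Proof.
apply/seteqP; split; first exact: sub_gclosure.
by case: i W => W u Wu v Wv; apply: Wu => w; apply.
Qed.

Definition gclose (P : polarity) (i : gsort) (W : set (Z P i)) : galois P i :=
  Galois (gclosure_galois W).

Definition gjoin (P : polarity) (i : gsort) (S : set (galois P i)) :
  galois P i := gclose (\bigcup_(A in S) (A : set (Z P i))).

(* gjoin S is the least upper bound of S with respect to inclusion. *)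
Lemma gjoinP (P : polarity) (i : gsort) (S : set (galois P i))
    (B : galois P i) :
  gjoin S `<=` B <-> (forall A : galois P i, S A -> A `<=` B).
Proof.
split=> [SB A SA u Au|SB].
  by apply: SB; apply: sub_gclosure; exists A.
by rewrite [gset B]gsetP; apply: gclosureS => u [A SA Au]; apply: SB Au.
Qed.

(* p[u]_k, where the (n-1)-tuple p[_]_k has no entry at place k. *)
Definition plug (n : nat) (T : 'I_n -> Type) (k : 'I_n)
    (p : forall j : 'I_n, j != k -> T j) (u : T k) (j : 'I_n) : T j :=
  match j =P k with
  | ReflectT ejk => ecast l (T l) (esym ejk) u
  | ReflectF njk => p j (contra_not_neq id njk)
  end.

Lemma plug_eq (n : nat) (T : 'I_n -> Type) (k : 'I_n)
    (p : forall j : 'I_n, j != k -> T j) (u : T k) : plug p u k = u.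
Proof.
rewrite /plug; case: eqP => [ekk|//].
by rewrite (eq_axiomK (esym ekk)).
Qed.

Lemma plug_neq (n : nat) (T : 'I_n -> Type) (k : 'I_n)
    (p : forall j : 'I_n, j != k -> T j) (u : T k) (j : 'I_n)
    (njk : j != k) : plug p u j = p j njk.
Proof.
rewrite /plug; case: eqP => [ejk|njk']; first by case/eqP: (njk).
by congr (p j _); apply: bool_irrelevance.
Qed.

(* A frame whose relation has sort (i0; i 0, ..., i (n-1)). *)
Record frame (n : nat) (i0 : gsort) (i : 'I_n -> gsort) := Frame {
  fpol :> polarity;
  frel : Z fpol i0 -> (forall j : 'I_n, Z fpol (i j)) -> Prop }.

Definition galois_dual (n : nat) (i0 : gsort) (i : 'I_n -> gsort)
    (F : frame i0 i) (u : Z F (bar i0)) (v : forall j : 'I_n, Z F (i j)) :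
  Prop := forall w : Z F i0, frel w v -> incid w u.

Definition dual_section (n : nat) (i0 : gsort) (i : 'I_n -> gsort)
    (F : frame i0 i) (k : 'I_n) (w : Z F (bar i0))
    (p : forall j : 'I_n, j != k -> Z F (i j)) : set (Z F (i k)) :=
  [set u | galois_dual w (plug p u)].

Definition alpha (n : nat) (i0 : gsort) (i : 'I_n -> gsort) (F : frame i0 i)
    (W : forall j : 'I_n, set (Z F (i j))) : set (Z F i0) :=
  \bigcup_(w in [set w : forall j : 'I_n, Z F (i j) | forall j, W j (w j)])
    [set u | frel u w].

Definition alpha_bar (n : nat) (i0 : gsort) (i : 'I_n -> gsort)
    (F : frame i0 i) (A : forall j : 'I_n, galois F (i j)) : galois F i0 :=
  gclose (alpha (fun j => A j : set (Z F (i j)))).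

(* Main.v *)
(** Let [G] be a Galois set containing the images of [alpha] at all members of
[S], and let [w] be incident with all of [G]. Fixing the coordinates other than
the [k]-th, the section of the Galois dual at [w] contains every member of [S];
being a Galois set, it contains their join. So every such [w] is
incident with the image at the join, which therefore lies in [G'' = G]. *)

Require Import Defs.
From mathcomp Require Import all_boot.
From mathcomp Require Import boolp classical_sets.

Set Implicit Arguments.
Unset Strict Implicit.
Unset Printing Implicit Defensive.

Local Open Scope classical_set_scope.

(** Proof irrelevance for the [gsetP] field reduces equality of Galois sets to that of the
    underlying sets. *)
Lemma galois_anti (P : polarity) (i : gsort) (A B : galois P i) :
  A `<=` B -> B `<=` A -> A = B.
Proof.
case: A B => [A gA] [B gB] /= AB BA.
have eAB : A = B by apply/seteqP.
by case: _ / eAB gB {AB BA} => gB; congr Galois; apply: Prop_irrelevance.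
Qed.

Lemma gclosure_min (P : polarity) (i : gsort) (W G : set (Z P i)) :
  is_galois G -> W `<=` G -> gclosure W `<=` G.
Proof. by move=> gG WG; rewrite gG; apply: gclosureS. Qed.

(** For either sort the closure unfolds to this condition; [incid] spares later proofs the case
    split. *)
Lemma gclosureE (P : polarity) (i : gsort) (W : set (Z P i)) (x : Z P i) :
  (forall w : Z P (bar i), (forall y, W y -> incid y w) -> incid x w) ->
  gclosure W x.
Proof. by case: i W x. Qed.

Lemma forall_plug (n : nat) (T : 'I_n -> Type) (k : 'I_n)
    (Q : forall j : 'I_n, T j -> Prop) (p : forall j : 'I_n, j != k -> T j)
    (u : T k) :
  Q k u -> (forall j njk, Q j (p j njk)) -> forall j, Q j (plug p u j).
Proof.
move=> Qu Qp j; have [->|njk] := eqVneq j k; first by rewrite plug_eq.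
by rewrite (plug_neq _ _ njk).
Qed.

Lemma plug_id (n : nat) (T : 'I_n -> Type) (k : 'I_n)
    (v : forall j : 'I_n, T j) : plug (fun j (_ : j != k) => v j) (v k) = v.
Proof.
apply: functional_extensionality_dep.
exact: (forall_plug (Q := fun j z => z = v j)).
Qed.

Lemma alphaS (n : nat) (i0 : gsort) (i : 'I_n -> gsort) (F : frame i0 i)
    (V W : forall j : 'I_n, set (Z F (i j))) :
  (forall j, V j `<=` W j) -> alpha V `<=` alpha W.
Proof. by move=> VW x [v Vv xv]; exists v => // j; apply: VW. Qed.

Lemma alpha_gjoin_sub (n : nat) (i0 : gsort) (i : 'I_n -> gsort)
    (F : frame i0 i) (k : 'I_n)
    (Hsec : forall (w : Z F (bar i0))
              (p : forall j : 'I_n, j != k -> Z F (i j)),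
              is_galois (dual_section w p))
    (A : forall j : 'I_n, j != k -> galois F (i j))
    (S : set (galois F (i k))) (G : galois F i0) :
  (forall B, S B -> alpha (fun j => plug A B j : set (Z F (i j))) `<=` G) ->
  alpha (fun j => plug A (gjoin S) j : set (Z F (i j))) `<=` G.
Proof.
move=> SG x [v Av xv]; rewrite [gset G]gsetP; apply: gclosureE => w Gw.
(* The section to use is the one through [v] itself: plugging [v k] back into [p] returns [v]. *)
pose p j (_ : j != k) := v j.
suff sec : dual_section w p (v k) by apply: sec; rewrite plug_id.
have vk : gset (gjoin S) (v k) by have := Av k; rewrite plug_eq.
apply: gclosure_min vk => // u [B SB Bu] y yu.
apply/Gw/(SG B SB); exists (plug p u) => //=.
(* Off [k], [plug A B] and [plug A (gjoin S)] agree, so membership of the entries of [v] carries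
   over. *)
apply: (forall_plug (Q := fun j => gset (plug A B j))) => [|j njk].
  by rewrite plug_eq.
by have := Av j; rewrite !(plug_neq _ _ njk).
Qed.

Theorem theorem2p17 (n : nat) (i0 : gsort) (i : 'I_n -> gsort)
    (F : frame i0 i) (k : 'I_n)
    (Hsec : forall (w : Z F (bar i0))
              (p : forall j : 'I_n, j != k -> Z F (i j)),
              is_galois (dual_section w p))
    (A : forall j : 'I_n, j != k -> galois F (i j))
    (S : set (galois F (i k))) :
  alpha_bar (plug A (gjoin S)) =
  gjoin [set alpha_bar (plug A B) | B in S].
Proof.
apply: galois_anti.
  apply: gclosure_min; first exact: gsetP.
  (* Here [G] is the join of the sets [alpha_bar (plug A B)]. *)
  apply: alpha_gjoin_sub => // B SB x xB.
  by apply: sub_gclosure; exists (alpha_bar (plug A B));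
    [exists B | apply: sub_gclosure].
(* The converse is monotonicity of closure and [alpha], as each [B] in [S] lies in [gjoin S]. *)
apply/gjoinP => _ [B SB <-]; apply/gclosureS/alphaS => j.
have [->|njk] := eqVneq j k; last by rewrite !(plug_neq _ _ njk).
by rewrite !plug_eq => u Bu; apply: sub_gclosure; exists B.
Qed.
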